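(* Let $n \ge 1$ be an integer and $\lambda > 0$ a real number. Then $$ \lim_{N\to\infty} \min\left\{ 1, \ \frac{1}{N+1} \left\lfloor \frac{n (N+1)(N^2 - 1 + N\lambda^2)}{N^2 \lambda^2} \right\rfloor \right\} = \min\left\{1, \frac{n}{\lambda^2}\right\}, $$ and this limit is the bound of the multivariate Chebyshev inequality over ellipsoids shaped according to the covariance and centered at the mean; that is, for every random variable $\xi$ in $\mathbb{R}^n$ with distribution $\mathbb{P}$, mean $\mu \in \mathbb{R}^n$ and nonsingular covariance matrix $\Sigma \in \mathbb{R}^{n\times n}$, $$ \mathbb{P}\left( (\xi-\mu)^\top \Sigma^{-1} (\xi-\mu) \ge \lambda^2 \right) \le \min\left\{1, \frac{n}{\lambda^2}\right\}. $$
   Context: Here $\lfloor\cdot\rfloor$ denotes the floor function, and $N$ ranges over the positive integers. The sequence in $N$ is the right-hand side of an empirical multivariate Chebyshev inequality in which the mean and covariance are estimated from $N$ samples in $\mathbb{R}^n$. *)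

(* Defs.v *)
From HB Require Import structures.
From mathcomp Require Import all_boot all_order all_algebra.
From mathcomp Require Import all_classical all_reals all_analysis.

Set Implicit Arguments.
Unset Strict Implicit.
Unset Printing Implicit Defensive.

Import Order.TTheory GRing.Theory Num.Theory.
Import numFieldNormedType.Exports.

Local Open Scope classical_set_scope.
Local Open Scope ring_scope.

(* A random vector in R^n is a random variable with values in [n.-tuple R],
   whose sigma-algebra is the one generated by the coordinate projections,
   i.e. the Borel sigma-algebra of R^n. *)

Definition tuple_cV (R : realType) (n : nat) (x : n.-tuple R) : 'cV[R]_n :=
  \col_i tnth x i.

Definition coord_rv (d : measure_display) (T : measurableType d)
    (R : realType) (P : probability T R) (n : nat)
    (xi : {RV P >-> n.-tuple R}) (i : 'I_n) : T -> R :=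
  fun w => tnth (xi w) i.

(* The membership in [Lfun] is needed because ['E_P[_]] and [covariance] are
   total: they also take values on functions that are not integrable. *)
Definition has_mean (d : measure_display) (T : measurableType d)
    (R : realType) (P : probability T R) (n : nat)
    (xi : {RV P >-> n.-tuple R}) (mu : 'cV[R]_n) : Prop :=
  forall i, coord_rv xi i \in Lfun P 1%E /\
            ('E_P[coord_rv xi i] = (mu i ord0)%:E)%E.

Definition has_covariance (d : measure_display) (T : measurableType d)
    (R : realType) (P : probability T R) (n : nat)
    (xi : {RV P >-> n.-tuple R}) (Sigma : 'M[R]_n) : Prop :=
  (forall i, coord_rv xi i \in Lfun P 2%:E) /\
  (forall i j, covariance P (coord_rv xi i) (coord_rv xi j) = (Sigma i j)%:E).

Definition quad_form (R : realType) (n : nat) (A : 'M[R]_n) (x : 'cV[R]_n) : R :=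
  (x^T *m A *m x) ord0 ord0.

(* Main.v *)
(* The second moments of [xi - mu] are the entries of [Sigma], so the expectation
   of the quadratic form of [Sigma^-1] at [xi - mu] is tr(Sigma^-1 Sigma) = n, and
   the inequality is Markov's; positivity of the form follows from that of [Sigma],
   whose form at [c] is the expectation of the squared linear form
   <c, xi - mu>^2.  For the limit, the floor changes the expression under the
   minimum by at most 1 / (N + 1), and without the floor it equals
   (n / lambda^2) (1 - 1 / N^2 + lambda^2 / N). *)
Require Import Defs.
From mathcomp Require Import all_boot all_order all_algebra.
From mathcomp Require Import all_classical all_reals all_analysis.
From mathcomp Require Import measurable_realfun ring.

Import Order.TTheory GRing.Theory Num.Theory.
Import numFieldNormedType.Exports.

Local Open Scope classical_set_scope.
Local Open Scope ring_scope.

Lemma quad_formE (R : realType) (n : nat) (A : 'M[R]_n) (x : 'cV[R]_n) :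
  quad_form A x = \sum_i \sum_j A i j * (x i ord0 * x j ord0).
Proof.
rewrite /quad_form mxE exchange_big /=; apply: eq_bigr => j _.
rewrite mxE mulr_suml; apply: eq_bigr => i _.
by rewrite mxE; ring.
Qed.

Lemma floor_ratio_cvg (R : realType) (u : R^nat) (l : R) :
  u @ \oo --> l ->
  (fun N : nat => 1 / (N%:R + 1) * (Num.floor ((N%:R + 1) * u N))%:~R) @ \oo
    --> l.
Proof.
move=> ul.
(* [harmonic N] is 1 / (N + 1): the floor loses at most 1, and the prefactor divides this loss by N
   + 1. *)
have ulB : (fun N => u N - harmonic N) @ \oo --> l.
  by rewrite -[l]subr0; apply: cvgB => //; exact: cvg_harmonic.
apply: (squeeze_cvgr _ ulB ul); apply: nearW => N /=.
have N0 : 0 < N%:R + 1 :> R by rewrite natr1 ltr0n.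
have -> : N.+1%:R^-1 = (N%:R + 1)^-1 :> R by rewrite natr1.
rewrite div1r; apply/andP; split; last first.
  by rewrite ler_pdivrMl// floor_le.
rewrite ler_pdivlMl// mulrBr divff ?gt_eqF// lerBlDr.
by rewrite -(intrD _ _ 1); apply/ltW/floorD1_gt.
Qed.

Lemma chebyshev_bound_cvg (R : realType) (n : nat) (lambda : R) :
  0 < lambda ->
  (fun N : nat => n%:R * (N%:R ^+ 2 - 1 + N%:R * lambda ^+ 2)
                  / (N%:R ^+ 2 * lambda ^+ 2)) @ \oo --> n%:R / lambda ^+ 2.
Proof.
(* Shifting the index avoids division by zero at N = 0 and turns 1 / N into [harmonic N]. *)
move=> l0; rewrite -cvg_shiftS /=.
have h0 : @harmonic R @ \oo --> (0 : R) by exact: cvg_harmonic.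
have -> : (fun N : nat => n%:R * (N.+1%:R ^+ 2 - 1 + N.+1%:R * lambda ^+ 2)
                  / (N.+1%:R ^+ 2 * lambda ^+ 2)) =
   (fun N : nat => n%:R / lambda ^+ 2 *
      (1 - harmonic N * harmonic N + lambda ^+ 2 * harmonic N)).
  apply/funext => N /=; field.
  by rewrite nat1r pnatr_eq0/= gt_eqF.
(* The limit is given the shape of the sequence, with 0 for [harmonic N], so that limits can be
   taken term by term. *)
rewrite [in X in _ --> X](_ : n%:R / lambda ^+ 2 =
    n%:R / lambda ^+ 2 * (1 - 0 * 0 + lambda ^+ 2 * 0)); last by ring.
apply: cvgM; first exact: cvg_cst.
apply: cvgD; last by apply: cvgM => //; exact: cvg_cst.
by apply: cvgB; [exact: cvg_cst | exact: cvgM].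
Qed.

Set Implicit Arguments.

Section second_moments.
Context (d : measure_display) (T : measurableType d) (R : realType).
Context (P : probability T R).

Lemma Lfun1_sum (I : Type) (s : seq I) (X : I -> T -> R) :
  (forall i, X i \in Lfun P 1%E) ->
  (fun w => \sum_(i <- s) X i w) \in Lfun P 1%E.
Proof.
move=> X1.
rewrite (_ : (fun w => _) = \sum_(i <- s) X i); last by rewrite fct_sumE.
by rewrite rpred_sum.
Qed.

Lemma expectation_bigsum (I : eqType) (s : seq I) (X : I -> T -> R) :
  (forall i, X i \in Lfun P 1%E) ->
  ('E_P[fun w => (\sum_(i <- s) X i w)%R])%E = (\sum_(i <- s) 'E_P[X i])%E.
Proof.
move=> X1.
(* [expectation_sum] takes a list of functions, so the indexed sum becomes a sum over the list of
   the [X i]. *)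
rewrite -(big_map X predT (fun f => 'E_P[f]%E)) -expectation_sum; last first.
  by move=> _ /mapP[i _ ->].
by rewrite big_map fct_sumE.
Qed.

Context (n : nat) (xi : {RV P >-> n.-tuple R}) (mu : 'cV[R]_n) (Sigma : 'M[R]_n).
Context (ximu : has_mean xi mu) (xiSigma : has_covariance xi Sigma).

(** Centered coordinates are in L^2, as constants are, and a product of two L^2 functions is in
    L^1. *)
Lemma centered_mul_Lfun1 i j :
  (fun w => (coord_rv xi i w - mu i ord0) * (coord_rv xi j w - mu j ord0))
    \in Lfun P 1%E.
Proof.
have c2 k : coord_rv xi k \- cst (mu k ord0) \in Lfun P 2%:E.
  by rewrite rpredB ?lee1n//= ?Lfun_cst// xiSigma.1.
exact: Lfun2_mul_Lfun1 (c2 i) (c2 j).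
Qed.

Lemma expectation_centered_mul i j :
  'E_P[fun w => ((coord_rv xi i w - mu i ord0) *
                 (coord_rv xi j w - mu j ord0))%R]%E = (Sigma i j)%:E.
Proof. by rewrite -xiSigma.2 covariance.unlock (ximu i).2 (ximu j).2. Qed.

(** Displays the form as a linear combination of products of centered coordinates, ready for
    linearity of expectation. *)
Lemma quad_form_centeredE (B : 'M[R]_n) :
  (fun w => quad_form B (tuple_cV (xi w) - mu)) =
  (fun w => \sum_i \sum_j (B i j \o* (fun w =>
    (coord_rv xi i w - mu i ord0) * (coord_rv xi j w - mu j ord0))) w).
Proof.
apply/funext => w; rewrite quad_formE; apply: eq_bigr => i _.
by apply: eq_bigr => j _; rewrite !mxE mulrC.
Qed.

Lemma quad_form_Lfun1 (B : 'M[R]_n) :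
  (fun w => quad_form B (tuple_cV (xi w) - mu)) \in Lfun P 1%E.
Proof.
rewrite quad_form_centeredE; do 2 apply: Lfun1_sum => ?.
by rewrite Lfun_scale//; exact: centered_mul_Lfun1.
Qed.

Lemma quad_form_measurable (B : 'M[R]_n) :
  measurable_fun setT (fun w => quad_form B (tuple_cV (xi w) - mu)).
Proof.
by have /Lfun1_integrable/measurable_int/measurable_EFinP := quad_form_Lfun1 B.
Qed.

Lemma measurable_quad_form_ge (B : 'M[R]_n) (a : R) :
  measurable [set w | a <= quad_form B (tuple_cV (xi w) - mu)].
Proof.
have /measurable_EFinP mQ := quad_form_measurable B.
by have := emeasurable_fun_c_infty measurableT mQ a%:E; rewrite setTI.
Qed.

Lemma expectation_quad_form (B : 'M[R]_n) :
  'E_P[fun w => quad_form B (tuple_cV (xi w) - mu)]%E =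
  (\sum_i \sum_j B i j * Sigma i j)%:E.
Proof.
rewrite quad_form_centeredE.
have BL i j : (B i j \o* (fun w => (coord_rv xi i w - mu i ord0) *
    (coord_rv xi j w - mu j ord0))) \in Lfun P 1%E.
  by rewrite Lfun_scale//; exact: centered_mul_Lfun1.
rewrite expectation_bigsum; last by move=> i; exact: Lfun1_sum.
rewrite -sumEFin; apply: eq_bigr => i _.
rewrite expectation_bigsum// -sumEFin; apply: eq_bigr => j _.
rewrite expectationZl; last exact: centered_mul_Lfun1.
by rewrite expectation_centered_mul EFinM.
Qed.

Lemma covariance_mx_sym : Sigma^T = Sigma.
Proof.
apply/matrixP => i j; rewrite mxE; apply: EFin_inj.
by rewrite -!xiSigma.2 covarianceC.
Qed.

Lemma covariance_mx_ge0 (c : 'cV[R]_n) : 0 <= quad_form Sigma c.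
Proof.
rewrite -lee_fin.
(* This is the double sum of [expectation_quad_form] for B = c c^T, and the form of c c^T at y is
   (c^T y)^2. *)
have -> : quad_form Sigma c = \sum_i \sum_j (c *m c^T) i j * Sigma i j.
  rewrite quad_formE; apply: eq_bigr => i _; apply: eq_bigr => j _.
  by rewrite mxE big_ord1 mxE mulrC.
rewrite -expectation_quad_form; apply: expectation_ge0 => w.
set y := _ - mu.
(* Regrouped as (y^T c)(c^T y), a product of two 1 x 1 matrices that are transposes of each
   other. *)
rewrite /quad_form mulmxA -mulmxA mxE big_ord1.
by rewrite -[c^T *m y]trmxK trmx_mul trmxK [(_^T) ord0 ord0]mxE -expr2 sqr_ge0.
Qed.

Context (Sigma_unit : Sigma \in unitmx).

(** By symmetry of Sigma, x^T Sigma^-1 x = z^T Sigma z with z = Sigma^-1 x. *)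
Lemma quad_form_invmx_ge0 (x : 'cV[R]_n) : 0 <= quad_form (invmx Sigma) x.
Proof.
rewrite (_ : quad_form _ x = quad_form Sigma (invmx Sigma *m x)).
  exact: covariance_mx_ge0.
rewrite /quad_form trmx_mul trmx_inv covariance_mx_sym.
by rewrite !mulmxA mulmxKV.
Qed.

Lemma expectation_quad_form_invmx :
  'E_P[fun w => quad_form (invmx Sigma) (tuple_cV (xi w) - mu)]%E = n%:R%:E.
Proof.
rewrite expectation_quad_form; congr EFin.
rewrite -(mxtrace1 R n) -(mulVmx Sigma_unit); apply: eq_bigr => i _.
rewrite mxE; apply: eq_bigr => j _.
by rewrite -{2}covariance_mx_sym mxE.
Qed.

Lemma multivariate_chebyshev (lambda : R) : 0 < lambda ->
  (P [set w | (lambda ^+ 2 <=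
                 quad_form (invmx Sigma) (tuple_cV (xi w) - mu))%R]
    <= (n%:R / lambda ^+ 2)%:E)%E.
Proof.
move=> l0; have l20 : 0 < lambda ^+ 2 by rewrite exprn_gt0.
pose Q w := quad_form (invmx Sigma) (tuple_cV (xi w) - mu).
have mQ := quad_form_measurable (invmx Sigma).
rewrite EFinM lee_pdivlMr// muleC -expectation_quad_form_invmx unlock.
(* Markov's inequality, with [id] as the monotone function: lambda^2 P(|Q| >= lambda^2) is at most
   the integral of |Q|. The absolute values go away because Q >= 0. *)
have := @le_integral_comp_abse _ _ _ P _ measurableT (EFin \o Q) (lambda ^+ 2)
  id (@measurable_id _ _ _) (fun _ => id) (fun _ _ _ _ => id) _ l20.
have Q0 w : 0 <= Q w by exact: quad_form_invmx_ge0.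
rewrite setTI; under eq_set => w do rewrite /= ger0_norm// lee_fin.
under eq_integral => w _ do rewrite /= ger0_norm//.
by apply; exact/measurable_EFinP.
Qed.

End second_moments.

Unset Implicit Arguments.

Theorem theorem2p2 (R : realType) (n : nat) (lambda : R)
    (hn : (1 <= n)%N) (hlambda : 0 < lambda) :
  ((fun N : nat =>
      Num.min 1
        (1 / (N%:R + 1) *
         (Num.floor (n%:R * (N%:R + 1) * (N%:R ^+ 2 - 1 + N%:R * lambda ^+ 2)
                     / (N%:R ^+ 2 * lambda ^+ 2)))%:~R)) @ \oo
     --> Num.min 1 (n%:R / lambda ^+ 2))
  /\
  (forall (d : measure_display) (T : measurableType d) (P : probability T R)
          (xi : {RV P >-> n.-tuple R}) (mu : 'cV[R]_n) (Sigma : 'M[R]_n),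
     has_mean xi mu ->
     has_covariance xi Sigma ->
     Sigma \in unitmx ->
     (P [set w | (lambda ^+ 2 <= quad_form (invmx Sigma) (tuple_cV (xi w) - mu))%R]
        <= (Num.min 1 (n%:R / lambda ^+ 2))%:E)%E).
Proof.
split; last first.
  move=> d T P xi mu Sigma ximu xiSigma Sigma_unit.
  (* The bound by 1 holds for any event, once the set is known to be measurable. *)
  rewrite EFin_min le_min multivariate_chebyshev// andbT probability_le1//.
  exact: (measurable_quad_form_ge _ xiSigma).
(* Since t -> min(1, t) is continuous, the limit can be taken under the minimum. *)
have min1 : {for n%:R / lambda ^+ 2, continuous (cst 1 \min id : R -> R^o)}.
  by apply: continuous_min; [exact: cst_continuous | exact].
apply: (continuous_cvg _ min1).
(* Brings the argument of the floor to the form (N + 1) * u N of [floor_ratio_cvg]. *)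
under eq_fun => N do rewrite [n%:R * _]mulrC -[_ * n%:R * _ * _]mulrA
  -[_ * n%:R * _]mulrA [n%:R * (_ / _)]mulrA.
exact/floor_ratio_cvg/chebyshev_bound_cvg.
Qed.
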